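(* Let $(\mathbf a,\mathbf b)$ be a Golay complementary pair of length $N\ge 1$ with associated polynomials $A(z)$, $B(z)$, let $m\ge 1$, and let $\pi=(\pi_1,\dots,\pi_m)$ be a permutation of $\{1,2,\dots,m\}$. Let $H$ be a positive integer, $\xi=e^{2\pi/H}$, and $\mathrm j=\sqrt{-1}$. For any $e_1,\dots,e_m,e'\in\mathbb R$, any $k_1,\dots,k_m,k',k''\in[0,H)$, and any non-negative integers $d_1,\dots,d_m,U$, define for $\mathbf x=(x_1,\dots,x_m)\in\{0,1\}^m$ $$f_{\rm r}(\mathbf x)=e_m x_{\pi_m}+\sum_{n=1}^{m-1}e_n\,(x_{\pi_n}+x_{\pi_{n+1}})_2+e',$$ $$g_{\rm r}(\mathbf x)=e_m(1+x_{\pi_m})_2+\sum_{n=1}^{m-1}e_n\,(x_{\pi_n}+x_{\pi_{n+1}})_2+e',$$ $$f_{\rm i}(\mathbf x)=\frac H2\sum_{n=1}^{m-1}x_{\pi_n}x_{\pi_{n+1}}+\sum_{n=1}^m k_n x_{\pi_n}+k',$$ $$g_{\rm i}(\mathbf x)=\frac H2\Big(x_{\pi_m}+\sum_{n=1}^{m-1}x_{\pi_n}x_{\pi_{n+1}}\Big)_2+\sum_{n=1}^m k_n x_{\pi_n}+k'',$$ $$f_{\rm s}(\mathbf x)=\sum_{n=1}^m d_n x_{\pi_n},\qquad S(\mathbf x,z)=A(z)\,(1+x_{\pi_1})_2+B(z)\,x_{\pi_1}.$$ Then the sequences $\mathbf c$ and $\mathbf d$ associated with the polynomials $$C(z)=\sum_{i=0}^{2^m-1}\check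 S(i,z)\,\xi^{\check f_{\rm r}(i)+\mathrm j\check f_{\rm i}(i)}\,z^{\check f_{\rm s}(i)+Ui},\qquad D(z)=\sum_{i=0}^{2^m-1}\check S(i,z)\,\xi^{\check g_{\rm r}(i)+\mathrm j\check g_{\rm i}(i)}\,z^{\check f_{\rm s}(i)+Ui}$$ form a Golay complementary pair.
   Context: $(\cdot)_2$ denotes reduction modulo 2 to an element of $\{0,1\}\subset\mathbb Z$; all other arithmetic is in $\mathbb R$ or $\mathbb C$. For a function $f$ of $\mathbf x=(x_1,\dots,x_m)\in\{0,1\}^m$, $\check f(i)$ denotes $f(\mathbf x)$ for the unique $\mathbf x$ with $i=\sum_{j=1}^m x_j2^{m-j}$ ($x_1$ is the most significant bit); likewise $\check S(i,z)=S(\mathbf x,z)$. For real $p,q$, $\xi^{p+\mathrm jq}=e^{2\pi(p+\mathrm jq)/H}$. A complex sequence $\mathbf a=(a_0,\dots,a_{N-1})$ of length $N$ (with $a_{N-1}\ne0$) is associated with the polynomial $A(z)=\sum_{i=0}^{N-1}a_iz^i$. Its aperiodic autocorrelation is $\rho_{\mathbf a}(k)=\sum_{i=0}^{N-k-1}a_i^*a_{i+k}$ for $0\le k\le N-1$, $\rho_{\mathbf a}(-k)=\rho_{\mathbf a}(k)^*$, and $0$ for $|k|\ge N$; it is unchanged by appending zeros to the sequence. A pair $(\mathbf a,\mathbf b)$ of sequences of the same length is a Golay complementary pair if $\rho_{\mathbf a}(k)+\rho_{\mathbf b}(k)=0$ for all $k\neq0$. For $\mathbf c,\mathbf d$ the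 coefficient sequences of $C,D$ are taken of common length $U(2^m-1)+N+\sum_n d_n$, trailing zeros being allowed. *)

(* Defs.v *)
From HB Require Import structures.
From mathcomp Require Import all_boot all_order all_algebra all_fingroup.
From mathcomp Require Import complex.
From mathcomp Require Import all_classical all_reals all_analysis.

Set Implicit Arguments.
Unset Strict Implicit.
Unset Printing Implicit Defensive.

Import Order.TTheory GRing.Theory Num.Theory.
Local Open Scope ring_scope.
Local Open Scope complex_scope.

Section Golay.
Variable R : realType.

(** The entries of [s] are s`_0, ..., s`_(N-1) with N = size s.  The truncated
    subtraction makes the sum empty, hence 0, for lags k >= N. *)
Definition acorr_nat (s : seq R[i]) (k : nat) : R[i] :=
  \sum_(i < size s - k) (s`_i)^* * s`_(i + k).

(** [Negz n] is the integer -(n+1). *)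
Definition acorr (s : seq R[i]) (k : int) : R[i] :=
  match k with
  | Posz n => acorr_nat s n
  | Negz n => (acorr_nat s n.+1)^*
  end.

Definition golay_pair (s t : seq R[i]) : Prop :=
  size s = size t /\ forall k : int, k != 0 -> acorr s k + acorr t k = 0.

(** The coefficients of [p] as a sequence of length [L], padded with zeros.
    It loses no coefficient exactly when [Poly (coef_seq L p) = p]. *)
Definition coef_seq (L : nat) (p : {poly R[i]}) : seq R[i] :=
  mkseq (fun i => p`_i) L.

Definition cexp (z : R[i]) : R[i] :=
  let: x +i* y := z in (expR x)%:C * (cos y +i* sin y).

(** xi^w with xi = e^(2 pi / H), for a complex exponent w. *)
Definition xi_pow (H : nat) (w : R[i]) : R[i] :=
  cexp ((2 * pi / H%:R)%:C * w).

End Golay.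

(** Binary vectors are 0-based: the variable x_(j+1) is [x j], so its weight
    2^(m-(j+1)) reads [2 ^ (m - j.+1)]. *)
Definition bvec (m : nat) := {ffun 'I_m -> bool}.

Definition bits_val (m : nat) (x : bvec m) : nat :=
  (\sum_(j < m) x j * 2 ^ (m - j.+1))%N.

Definition bits (m i : nat) : bvec m :=
  [ffun j : 'I_m => odd (i %/ 2 ^ (m - j.+1))].

(** [bits m i] is the unique binary vector of value [i], by the next two
    lemmas. *)
Lemma bitsK (m i : nat) : (i < 2 ^ m)%N -> bits_val (bits m i) = i.
Proof.
rewrite /bits_val; elim: m i => [|m IHm] i lti.
  by rewrite big_ord0; case: i lti.
have lti2 : (i./2 < 2 ^ m)%N by rewrite -divn2 ltn_divLR // -expnSr.
rewrite big_ord_recr /= ffunE subnn expn0 divn1 muln1.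
rewrite -[RHS]odd_double_half addnC -muln2 -(IHm _ lti2) big_distrl /=.
congr (_ + _)%N; apply: eq_bigr => j _; rewrite !ffunE /=.
by rewrite subSn // expnS divnMA divn2 mulnA mulnAC -mulnA [(_ * 2)%N]mulnC mulnA.
Qed.

Lemma bits_valK (m : nat) : cancel (@bits_val m) (bits m).
Proof.
move=> x; have bits_inj : injective (fun i : 'I_(2 ^ m) => bits m i).
  by move=> i j /= /(congr1 (@bits_val m)); rewrite !bitsK // => /val_inj.
have /codomP [i ->] : x \in codom (fun i : 'I_(2 ^ m) => bits m i).
  by apply: inj_card_onto => //; rewrite card_ffun card_bool !card_ord.
by rewrite bitsK.
Qed.

(** For a function f of m bits, f read as a function of an integer i < 2^m. *)
Definition check (T : Type) (m : nat) (f : bvec m -> T) (i : nat) : T :=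
  f (bits m i).

(** The number of variables is m+1, and 1-based indices are shifted by one:
    pi_1 is [sg ord0], pi_(m+1) is [sg ord_max], and for the n-th of the m
    consecutive pairs, n : 'I_m, the two indices are [lo n] and [hi n]. *)
Definition lo (m : nat) (n : 'I_m) : 'I_m.+1 := widen_ord (leqnSn m) n.
Definition hi (m : nat) (n : 'I_m) : 'I_m.+1 := lift ord0 n.

Section Functions.
Variables (R : realType) (m : nat) (sg : {perm 'I_m.+1}).
Implicit Type x : bvec m.+1.

Definition f_r (e : 'I_m.+1 -> R) (e' : R) x : R :=
  e ord_max * (x (sg ord_max))%:R
  + \sum_(n < m) e (lo n) * ((x (sg (lo n)) + x (sg (hi n))) %% 2)%N%:R
  + e'.

Definition g_r (e : 'I_m.+1 -> R) (e' : R) x : R :=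
  e ord_max * ((1 + x (sg ord_max)) %% 2)%N%:R
  + \sum_(n < m) e (lo n) * ((x (sg (lo n)) + x (sg (hi n))) %% 2)%N%:R
  + e'.

Definition f_i (H : nat) (k : 'I_m.+1 -> R) (k' : R) x : R :=
  H%:R / 2 * (\sum_(n < m) (x (sg (lo n)) * x (sg (hi n)))%N%:R)
  + \sum_(n < m.+1) k n * (x (sg n))%:R
  + k'.

Definition g_i (H : nat) (k : 'I_m.+1 -> R) (k'' : R) x : R :=
  H%:R / 2
    * ((x (sg ord_max) + \sum_(n < m) x (sg (lo n)) * x (sg (hi n))) %% 2)%N%:R
  + \sum_(n < m.+1) k n * (x (sg n))%:R
  + k''.

Definition f_s (d : 'I_m.+1 -> nat) x : nat :=
  (\sum_(n < m.+1) d n * x (sg n))%N.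

Definition S_fun (A B : {poly R[i]}) x : {poly R[i]} :=
  A *+ ((1 + x (sg ord0)) %% 2)%N + B *+ x (sg ord0).

End Functions.

Definition encoded_poly (R : realType) (m H U : nat)
    (S : bvec m -> {poly R[i]}) (fr fi : bvec m -> R) (fs : bvec m -> nat)
    : {poly R[i]} :=
  \sum_(i < 2 ^ m)
     check S i * (xi_pow H (check fr i +i* check fi i))%:P
     * 'X^(check fs i + U * i).

(* Main.v *)
(** Relabel the variables as y_n = x_(pi_n), so that only consecutive y_n
    interact.  Summing over y_1 first replaces (A, B) by the pair
    (A + E_1 G_1 B, E_1 A - G_1 B), where E_1 is a positive real and G_1 a
    monomial with unimodular coefficient, and leaves a sum of the same shape in
    y_2, ..., y_m.  After m steps, C and D are the two entries of the last pair,
    up to constants of equal modulus.  Each step preserves complementarity, as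
    |p + E q|^2 + |E p - q|^2 = (1 + E^2) (|p|^2 + |q|^2) and |G_1| = 1 on the
    unit circle. *)

Require Import Defs.
From HB Require Import structures.
From mathcomp Require Import all_boot all_order all_algebra all_fingroup.
From mathcomp Require Import complex.
From mathcomp Require Import all_classical all_reals all_analysis.
From mathcomp Require Import ring zify.

Set Implicit Arguments.
Unset Strict Implicit.
Unset Printing Implicit Defensive.

Import Order.TTheory GRing.Theory Num.Theory.
Local Open Scope ring_scope.
Local Open Scope complex_scope.

(** * Autocorrelations at non-negative lags *)

Section Autocorrelation.
Variable R : realType.
Implicit Types (s t : seq R[i]) (p q : {poly R[i]}).

(** The conjugation of [acorr] is [Num.conj], written [^*%R] here because [^*]
    alone may denote [conjc]. *)

(** The added terms read past the end of [s], where the default is 0; one bound [M] then serves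
    sequences of different lengths. *)
Lemma acorr_nat_widen s M k : (size s <= M)%N ->
  acorr_nat s k = \sum_(i < M) (s`_i)^*%R * s`_(i + k).
Proof.
move=> sM; rewrite /acorr_nat.
rewrite (big_ord_widen M (fun i => (s`_i)^*%R * s`_(i + k))); last first.
  exact: leq_trans (leq_subr _ _) sM.
rewrite big_mkcond; apply: eq_bigr => i _; case: ltnP => // le_i.
by rewrite [s`_(i + k)]nth_default ?mulr0 // addnC -leq_subLR.
Qed.

(** Makes trailing zeros harmless, so that a padded sequence can be traded for the polynomial
    itself. *)
Lemma eq_acorr_nat s t k : nth 0 s =1 nth 0 t -> acorr_nat s k = acorr_nat t k.
Proof.
move=> st; rewrite (acorr_nat_widen _ (leq_maxl (size s) (size t))).
rewrite (acorr_nat_widen _ (leq_maxr (size s) (size t))).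
by apply: eq_bigr => i _; rewrite !st.
Qed.

(** Negative lags carry the conjugates of the positive ones. *)
Lemma golay_pairP s t : size s = size t ->
  golay_pair s t <-> forall k, acorr_nat s k.+1 + acorr_nat t k.+1 = 0.
Proof.
move=> st; split=> [[_ st0] k|st0]; first exact: (st0 k.+1).
split=> // -[[|n]|n] // _; first exact: st0.
by rewrite /= -rmorphD st0 rmorph0.
Qed.

Lemma acorr_natCXM (c : R[i]) n p k :
  acorr_nat (c%:P * 'X^n * p) k = c^*%R * c * acorr_nat p k.
Proof.
rewrite (@acorr_nat_widen _ (n + size p)); last first.
  rewrite mulrAC; apply: leq_trans (size_polyMleq _ _) _.
  rewrite size_polyXn addnS /= addnC leq_add2l mul_polyC; exact: size_scale_leq.
rewrite big_split_ord /= big1 => [|i _]; last first.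
  by rewrite -mulrA coefCM coefXnM ltn_ord mulr0 rmorph0 mul0r.
rewrite add0r (acorr_nat_widen _ (leqnn _)) big_distrr /=.
apply: eq_bigr => i _; rewrite -!mulrA !coefCM !coefXnM.
rewrite -addnA !ltnNge !leq_addr /=.
rewrite !addKn rmorphM /=; ring.
Qed.

(** As [E] is real, the cross terms carry [E] in one autocorrelation and [- E] in the other, and
    cancel. *)
Lemma acorr_nat_butterfly (E : R[i]) p q k : E^*%R = E ->
  acorr_nat (p + E%:P * q) k + acorr_nat (E%:P * p - q) k =
  (1 + E ^+ 2) * (acorr_nat p k + acorr_nat q k).
Proof.
move=> Er; pose M := maxn (maxn (size (p + E%:P * q)%R) (size (E%:P * p - q)%R))
                       (maxn (size p) (size q)).
rewrite !(@acorr_nat_widen _ M) ?leq_max ?leqnn ?orbT //.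
rewrite -!big_split big_distrr /=.
apply: eq_bigr => i _; rewrite !coefD !coefN !coefCM.
rewrite !rmorphD !rmorphN !rmorphM /= Er.
ring.
Qed.

End Autocorrelation.

(** * Sums over binary vectors *)

Section BinaryVectors.

(** Uncurried so that it is a bijection from [bool * bvec m], along which sums can be reindexed. *)
Definition bcons (m : nat) (u : bool * bvec m) : bvec m.+1 :=
  [ffun j => if unlift ord0 j is Some j' then u.2 j' else u.1].

Lemma bcons0 m (u : bool * bvec m) : bcons u ord0 = u.1.
Proof. by rewrite ffunE unlift_none. Qed.

Lemma bconsS m (u : bool * bvec m) j : bcons u (lift ord0 j) = u.2 j.
Proof. by rewrite ffunE liftK. Qed.

Lemma bcons_bij m : bijective (@bcons m).
Proof.
exists (fun y : bvec m.+1 => (y ord0, [ffun j => y (lift ord0 j)] : bvec m))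
  => [[t y]|y].
  by rewrite bcons0; congr pair; apply/ffunP => j; rewrite ffunE bconsS.
apply/ffunP => j; case: (unliftP ord0 j) => [j'|] ->.
  by rewrite bconsS ffunE.
by rewrite bcons0.
Qed.

Lemma sum_bvec_recl (V : nmodType) m (F : bvec m.+1 -> V) :
  \sum_y F y = \sum_y (F (bcons (false, y)) + F (bcons (true, y))).
Proof.
rewrite (reindex _ (onW_bij _ (bcons_bij m))) /=.
rewrite -(pair_bigA _ (fun t y => F (bcons (t, y)))) big_bool /= addrC.
by rewrite -big_split.
Qed.

Lemma sum_bvec0 (V : nmodType) (F : bvec 0 -> V) y : \sum_x F x = F y.
Proof.
rewrite (bigD1 y) //= big1 ?addr0 // => x /eqP[]; apply/ffunP; by case.
Qed.

Lemma sum_check (V : nmodType) m (F : bvec m -> nat -> V) :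
  \sum_(i < 2 ^ m) check (fun x => F x i) i = \sum_x F x (bits_val x).
Proof.
rewrite (reindex (fun i : 'I_(2 ^ m) => bits m i)) /=.
  by apply: eq_bigr => i _; rewrite bitsK.
apply/onW_bij/inj_card_bij; last by rewrite card_ffun card_bool !card_ord.
by move=> i j /= /(congr1 (@bits_val m)); rewrite !bitsK // => /val_inj.
Qed.

Lemma permute_bvec_bij m (sg : {perm 'I_m}) :
  bijective (fun y : bvec m => [ffun j => y (sg^-1%g j)] : bvec m).
Proof.
exists (fun x : bvec m => [ffun j => x (sg j)] : bvec m) => x; apply/ffunP => j.
  by rewrite !ffunE permK.
by rewrite !ffunE permKV.
Qed.

End BinaryVectors.

(** * The recursion along the path y_1, ..., y_m *)

Section Encoding.
Variable T : comPzRingType.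

(** Factors common to the terms of C and D: each edge of the path contributes its [E] if its two
    bits differ and a sign if both are 1, each vertex with bit 1 its [G]. *)
Definition path_weight m (E G : 'I_m.+1 -> T) (y : bvec m.+1) : T :=
  \prod_(n < m) (E (lo n) ^+ (y (lo n) (+) y (hi n))
                 * (-1) ^+ (y (lo n) && y (hi n)))
  * \prod_(n < m.+1) G n ^+ y n.

Definition seed (p q : T) m (y : bvec m.+1) := if y ord0 then q else p.

(** Up to constants, C is [path_sum] and D is [path_mate]; only the factor of the last bit
    differs. *)
Definition path_sum m (E G : 'I_m.+1 -> T) p q :=
  \sum_y seed p q y * E ord_max ^+ y ord_max * path_weight E G y.

Definition path_mate m (E G : 'I_m.+1 -> T) p q :=
  \sum_y seed p q y * (E ord_max ^+ (~~ y ord_max) * (-1) ^+ y ord_max)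
         * path_weight E G y.

Lemma lift0_max m : lift ord0 ord_max = ord_max :> 'I_m.+2.
Proof. exact: val_inj. Qed.

Lemma lo0 m : lo ord0 = ord0 :> 'I_m.+2.
Proof. exact: val_inj. Qed.

Lemma lo_lift m (n : 'I_m) : lo (lift ord0 n) = lift ord0 (lo n).
Proof. exact: val_inj. Qed.

Lemma path_weight_bcons m (E G : 'I_m.+2 -> T) t (y : bvec m.+1) :
  path_weight E G (bcons (t, y)) =
  E ord0 ^+ (t (+) y ord0) * (-1) ^+ (t && y ord0) * G ord0 ^+ t
  * path_weight (E \o lift ord0) (G \o lift ord0) y.
Proof.
rewrite /path_weight big_ord_recl [X in _ * X = _]big_ord_recl /=.
rewrite lo0 /hi !bcons0 !bconsS /=.
under eq_bigr => n _ do rewrite lo_lift !bconsS /=.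
under [X in _ * (_ * X) = _]eq_bigr => n _ do rewrite bconsS.
rewrite /=; ring.
Qed.

Lemma seed_bcons m p q (t : bool) (y : bvec m) :
  seed p q (bcons (t, y)) = if t then q else p.
Proof. by rewrite /seed bcons0. Qed.

(** Only y_2 interacts with y_1. Summing over y_1 gives p + E G q when y_2 = 0 and E p - G q when
    y_2 = 1, which is the new seed. *)
Lemma path_sum_recl m (E G : 'I_m.+2 -> T) p q :
  path_sum E G p q =
  path_sum (E \o lift ord0) (G \o lift ord0)
    (p + E ord0 * (G ord0 * q)) (E ord0 * p - G ord0 * q).
Proof.
rewrite /path_sum sum_bvec_recl; apply: eq_bigr => y _.
rewrite !path_weight_bcons !seed_bcons -lift0_max !bconsS /seed /=.
by case: (y ord0) => /=; ring.
Qed.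

(** The new pair is that of [path_sum], since the last factor does not involve the first bit. *)
Lemma path_mate_recl m (E G : 'I_m.+2 -> T) p q :
  path_mate E G p q =
  path_mate (E \o lift ord0) (G \o lift ord0)
    (p + E ord0 * (G ord0 * q)) (E ord0 * p - G ord0 * q).
Proof.
rewrite /path_mate sum_bvec_recl; apply: eq_bigr => y _.
rewrite !path_weight_bcons !seed_bcons -lift0_max !bconsS /seed /=.
by case: (y ord0) => /=; ring.
Qed.

Lemma path_pair_ind (Q : T -> T -> Prop) m (E G : 'I_m.+1 -> T) p q :
  (forall n p q, Q p q -> Q (p + E n * (G n * q)) (E n * p - G n * q)) ->
  Q p q -> Q (path_sum E G p q) (path_mate E G p q).
Proof.
elim: m => [|m IHm] in E G p q *; move=> QS Qpq; last first.
  by rewrite path_sum_recl path_mate_recl; apply: IHm => [n|]; exact: QS.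
(* With a single bit the last factor takes the place of an edge, so the base case is one more step
   of the recursion. *)
suff [-> ->] : path_sum E G p q = p + E ord0 * (G ord0 * q) /\
               path_mate E G p q = E ord0 * p - G ord0 * q by exact: QS.
have max0 : ord_max = ord0 :> 'I_1 by exact: val_inj.
have y0 : bvec 0 := [ffun=> false].
rewrite /path_sum /path_mate !sum_bvec_recl !(sum_bvec0 _ y0) !seed_bcons.
rewrite /path_weight !big_ord0 !big_ord1 max0 !bcons0 /=.
by split; ring.
Qed.

End Encoding.

(** * Powers of xi *)

Section Exponential.
Variables (R : realType) (H : nat).
Hypothesis H_gt0 : (0 < H)%N.

Definition cis (y : R) : R[i] := cos y +i* sin y.

Lemma cisD x y : cis (x + y) = cis x * cis y.
Proof. by rewrite /cis cosD sinD; simpc; rewrite [cos x * sin y + _]addrC. Qed.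

Lemma cis0 : cis 0 = 1.
Proof. by rewrite /cis cos0 sin0. Qed.

Lemma cis_pi_nat n : cis (pi * n%:R) = (-1) ^+ n.
Proof.
elim: n => [|n IHn]; first by rewrite mulr0 cis0.
rewrite -addn1 natrD mulrDr mulr1 cisD IHn exprD expr1; congr (_ * _).
by rewrite /cis cospi sinpi; simpc.
Qed.

Lemma conj_cisM y : (cis y)^*%R * cis y = 1.
Proof.
have -> : (cis y)^*%R = cos y -i* sin y by [].
by rewrite /cis; simpc; rewrite -!expr2 cos2Dsin2 mulrC subrr.
Qed.

(** The positive and the unimodular factor of xi^(u + jv): the first yields the [E], the second the
    signs and the coefficients of the [G]. *)
Definition xi_re (r : R) : R[i] := (expR (2 * pi / H%:R * r))%:C.
Definition xi_im (r : R) : R[i] := cis (2 * pi / H%:R * r).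

Lemma xi_powE u v : xi_pow H (u +i* v) = xi_re u * xi_im v.
Proof.
rewrite /xi_pow; set r := _ / _.
by have -> : r%:C * (u +i* v) = (r * u) +i* (r * v) by simpc.
Qed.

Lemma xi_reD u v : xi_re (u + v) = xi_re u * xi_re v.
Proof. by rewrite /xi_re mulrDr expRD rmorphM. Qed.

Lemma xi_re0 : xi_re 0 = 1.
Proof. by rewrite /xi_re mulr0 expR0. Qed.

Lemma xi_reMb u (t : bool) : xi_re (u * t%:R) = xi_re u ^+ t.
Proof. by case: t; rewrite ?mulr1 ?mulr0 ?xi_re0. Qed.

Lemma conj_xi_re u : (xi_re u)^*%R = xi_re u.
Proof. exact: conjc_real. Qed.

Lemma xi_imD u v : xi_im (u + v) = xi_im u * xi_im v.
Proof. by rewrite /xi_im mulrDr cisD. Qed.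

Lemma xi_im0 : xi_im 0 = 1.
Proof. by rewrite /xi_im mulr0 cis0. Qed.

Lemma xi_imMb u (t : bool) : xi_im (u * t%:R) = xi_im u ^+ t.
Proof. by case: t; rewrite ?mulr1 ?mulr0 ?xi_im0. Qed.

Lemma conj_xi_imM u : (xi_im u)^*%R * xi_im u = 1.
Proof. exact: conj_cisM. Qed.

(** The angle is pi times [n]. This turns the quadratic part of the phases into signs. *)
Lemma xi_im_half n : xi_im (H%:R / 2 * n%:R) = (-1) ^+ n.
Proof.
rewrite /xi_im -cis_pi_nat; congr cis; field.
by rewrite pnatr_eq0 -lt0n.
Qed.

End Exponential.

(** * C and D as path sums *)

Section EncodedPolynomial.
Variables (R : realType) (m H U : nat) (sg : {perm 'I_m.+1}).
Hypothesis H_gt0 : (0 < H)%N.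
Variables (e k : 'I_m.+1 -> R) (e' : R) (d : 'I_m.+1 -> nat).

Definition amplitude n : {poly R[i]} := (xi_re H (e n))%:P.
(** The bit y_n is worth [2 ^ (m.+1 - (sg n).+1)] in the integer i, so U i splits into one shift per
    bit. *)
Definition monomial n : {poly R[i]} :=
  (xi_im H (k n))%:P * 'X^(d n + U * 2 ^ (m.+1 - (sg n).+1)).

Lemma encoded_poly_permute S fr fi fs :
  encoded_poly H U S fr fi fs =
  \sum_(y : bvec m.+1) let x := [ffun j => y (sg^-1%g j)] : bvec m.+1 in
    S x * (xi_pow H (fr x +i* fi x))%:P * 'X^(fs x + U * bits_val x)
  :> {poly R[i]}.
Proof.
transitivity (\sum_x S x * (xi_pow H (fr x +i* fi x))%:P
                   * 'X^(fs x + U * bits_val x)).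
  exact: (sum_check (fun x i =>
    S x * (xi_pow H (fr x +i* fi x))%:P * 'X^(fs x + U * i))).
exact: reindex (onW_bij _ (permute_bvec_bij sg)).
Qed.

Lemma modn2_addb (s t : bool) : ((s + t) %% 2)%N = s (+) t :> nat.
Proof. by case: s; case: t. Qed.

Lemma S_fun_seed A B (x y : bvec m.+1) : x (sg ord0) = y ord0 ->
  S_fun sg A B x = seed A B y :> {poly R[i]}.
Proof. by move=> xy; rewrite /S_fun /seed xy; case: (y ord0); rewrite ?addr0 ?add0r. Qed.

Section Term.
Variable y : bvec m.+1.
Let x : bvec m.+1 := [ffun j => y (sg^-1%g j)].

Let xE n : x (sg n) = y n.
Proof. by rewrite ffunE permK. Qed.

(** The exponent parts shared by C and D: amplitude [w], linear phase [v], and quadratic phase [s]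
    before the factor H/2. *)
Let w : R := \sum_(n < m) e (lo n) * (y (lo n) (+) y (hi n))%:R.
Let v : R := \sum_(n < m.+1) k n * (y n)%:R.
Let s : nat := (\sum_(n < m) (y (lo n) && y (hi n)))%N.

Lemma path_weightE :
  path_weight amplitude monomial y =
  (xi_re H w * (-1) ^+ s * xi_im H v)%:P * 'X^(f_s sg d x + U * bits_val x).
Proof.
have -> : (f_s sg d x + U * bits_val x =
    \sum_(n < m.+1) (d n + U * 2 ^ (m.+1 - (sg n).+1)) * y n)%N.
  rewrite /f_s /bits_val [X in (_ + U * X)%N](reindex_inj (@perm_inj _ sg)).
  rewrite big_distrr -big_split /=.
  by apply: eq_bigr => n _; rewrite !xE mulnDl -mulnA [(2 ^ _ * _)%N]mulnC.
rewrite /w /v /s /path_weight (big_morph _ (@xi_reD R H) (@xi_re0 R H)).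
rewrite (big_morph _ (@xi_imD R H) (@xi_im0 R H)).
rewrite (big_morph _ (@exprD _ (-1)) (@expr0 _ (-1))).
rewrite (big_morph _ (@exprD _ 'X) (@expr0 _ 'X)).
rewrite -big_split !rmorphM !rmorph_prod /= -mulrA -big_split; congr (_ * _).
  apply: eq_bigr => n _; rewrite /amplitude xi_reMb rmorphM !rmorphXn /=.
  by rewrite rmorphN1.
apply: eq_bigr => n _; rewrite /monomial xi_imMb rmorphXn /=.
by rewrite exprMn exprM.
Qed.

Lemma xi_powfE k' :
  xi_pow H (f_r sg e e' x +i* f_i sg H k k' x) =
  xi_re H e' * xi_im H k' *
  (xi_re H (e ord_max) ^+ y ord_max * (xi_re H w * (-1) ^+ s * xi_im H v)).
Proof.
rewrite xi_powE /f_r /f_i !xi_reD !xi_imD xE xi_reMb.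
under eq_bigr => n _ do rewrite modn2_addb !xE.
under [X in xi_im H (_ * X)]eq_bigr => n _ do rewrite mulnb !xE.
under [X in _ * xi_im H X * xi_im H k']eq_bigr => n _ do rewrite xE.
rewrite -natr_sum xi_im_half // -/w -/v -/s; ring.
Qed.

Lemma xi_powgE k' :
  xi_pow H (g_r sg e e' x +i* g_i sg H k k' x) =
  xi_re H e' * xi_im H k' *
  (xi_re H (e ord_max) ^+ (~~ y ord_max) * (-1) ^+ y ord_max
   * (xi_re H w * (-1) ^+ s * xi_im H v)).
Proof.
rewrite xi_powE /g_r /g_i !xi_reD !xi_imD xE (modn2_addb true) xi_reMb.
under eq_bigr => n _ do rewrite modn2_addb !xE.
under [X in (_ + X)%N]eq_bigr => n _ do rewrite mulnb !xE.
under [X in _ * xi_im H X * xi_im H k']eq_bigr => n _ do rewrite xE.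
(* Reduction modulo 2 is invisible in an exponent of -1, and the extra summand x_(pi_m) gives the
   sign of the last bit. *)
rewrite xi_im_half // -/w -/v -/s modn2 signr_odd exprD addTb; ring.
Qed.

End Term.

Lemma encoded_fE A B k' :
  encoded_poly H U (S_fun sg A B) (f_r sg e e') (f_i sg H k k') (f_s sg d) =
  (xi_re H e' * xi_im H k')%:P * path_sum amplitude monomial A B.
Proof.
rewrite encoded_poly_permute /path_sum big_distrr; apply: eq_bigr => y _ /=.
rewrite (@S_fun_seed _ _ _ y) ?ffunE ?permK // xi_powfE path_weightE /amplitude.
rewrite !rmorphM !rmorphXn /=; ring.
Qed.

Lemma encoded_gE A B k' :
  encoded_poly H U (S_fun sg A B) (g_r sg e e') (g_i sg H k k') (f_s sg d) =
  (xi_re H e' * xi_im H k')%:P * path_mate amplitude monomial A B.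
Proof.
rewrite encoded_poly_permute /path_mate big_distrr; apply: eq_bigr => y _ /=.
rewrite (@S_fun_seed _ _ _ y) ?ffunE ?permK // xi_powgE path_weightE /amplitude.
rewrite !rmorphM !rmorphXn !rmorphN1 /=; ring.
Qed.

(** The three summands bound U i, the size of S and f_s. *)
Lemma size_encoded_poly N (A B : {poly R[i]}) fr fi :
  (0 < N)%N -> (size A <= N)%N -> (size B <= N)%N ->
  (size (encoded_poly H U (S_fun sg A B) fr fi (f_s sg d))
   <= U * (2 ^ m.+1 - 1) + N + \sum_(n < m.+1) d n)%N.
Proof.
move=> N_gt0 sA sB; apply: leq_trans (size_sum _ _ _) _.
apply/bigmax_leqP => i _; rewrite /check.
set x := bits _ _.
have fs_le : (f_s sg d x <= \sum_(n < m.+1) d n)%N.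
  by apply: leq_sum => n _; case: (x _); rewrite ?muln1 ?muln0.
have Ui_le : (U * i <= U * (2 ^ m.+1 - 1))%N.
  by rewrite leq_mul2l; have := ltn_ord i; lia.
have sS : (size (S_fun sg A B x) <= N)%N.
  (* Only the first bit of the relabelled vector matters: S is A or B. *)
  by rewrite (@S_fun_seed _ _ _ [ffun j => x (sg j)]) ?ffunE // /seed; case: ifP.
rewrite mulrAC mulrC mul_polyC; apply: leq_trans (size_scale_leq _ _) _.
apply: leq_trans (size_polyMleq _ _) _; rewrite size_polyXn.
by move: fs_le Ui_le sS; lia.
Qed.

End EncodedPolynomial.

(** * Complementarity of C and D *)

Lemma coef_seqK (R : realType) L (p : {poly R[i]}) :
  (size p <= L)%N -> Poly (coef_seq L p) = p.
Proof.
move=> pL; apply/polyP => i; rewrite coef_Poly.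
case: (ltnP i L) => iL; first by rewrite nth_mkseq.
by rewrite !nth_default ?size_mkseq // (leq_trans pL).
Qed.

Theorem theorem2 (R : realType)
    (N : nat) (hN : (1 <= N)%N) (a b : N.-tuple R[i])
    (ha : a`_N.-1 != 0) (hb : b`_N.-1 != 0) (hab : golay_pair a b)
    (m : nat) (sg : {perm 'I_m.+1})
    (H : nat) (hH : (0 < H)%N)
    (e : 'I_m.+1 -> R) (e' : R)
    (k : 'I_m.+1 -> R) (k' k'' : R)
    (hk : forall n, 0 <= k n < H%:R)
    (hk' : 0 <= k' < H%:R) (hk'' : 0 <= k'' < H%:R)
    (d : 'I_m.+1 -> nat) (U : nat) :
  let A := Poly a in
  let B := Poly b in
  let S := S_fun sg A B in
  let C := encoded_poly H U S (f_r sg e e') (f_i sg H k k') (f_s sg d) in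
  let D := encoded_poly H U S (g_r sg e e') (g_i sg H k k'') (f_s sg d) in
  let L := (U * (2 ^ m.+1 - 1) + N + \sum_(n < m.+1) d n)%N in
  [/\ Poly (coef_seq L C) = C, Poly (coef_seq L D) = D
    & golay_pair (coef_seq L C) (coef_seq L D)].
Proof.
move=> A B S C D L.
have sA : (size A <= N)%N by apply: leq_trans (size_Poly _) _; rewrite size_tuple.
have sB : (size B <= N)%N by apply: leq_trans (size_Poly _) _; rewrite size_tuple.
have CK : Poly (coef_seq L C) = C by apply/coef_seqK/size_encoded_poly.
have DK : Poly (coef_seq L D) = D by apply/coef_seqK/size_encoded_poly.
split=> //; apply/golay_pairP => [|n]; first by rewrite !size_mkseq.
rewrite (@eq_acorr_nat _ _ C) => [|i]; last by rewrite -[in RHS]CK coef_Poly.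
rewrite (@eq_acorr_nat _ (coef_seq L D) D) => [|i]; last first.
  by rewrite -[in RHS]DK coef_Poly.
rewrite /C /D encoded_fE // encoded_gE //.
set E := amplitude H e; set G := monomial _ _ _ _ _.
have acorrC c (p : {poly R[i]}) l :
    acorr_nat (c%:P * p) l = c^*%R * c * acorr_nat p l.
  by rewrite -(acorr_natCXM c 0) expr0 mulr1.
(* The two constants have the same squared modulus, as k' and k'' only change the phase. *)
have normc x :
    (xi_re H e' * xi_im H x)^*%R * (xi_re H e' * xi_im H x) = xi_re H e' ^+ 2.
  by rewrite rmorphM /= conj_xi_re mulrACA conj_xi_imM mulr1.
rewrite !acorrC !normc -mulrDr.
(* The invariant of the recursion is complementarity at positive lags. *)
pose Q (p q : {poly R[i]}) := forall l, acorr_nat p l.+1 + acorr_nat q l.+1 = 0.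
suff QEG : Q (path_sum E G A B) (path_mate E G A B) by rewrite QEG mulr0.
apply: (path_pair_ind (Q := Q)) => [i p q Qpq l|l].
  (* The butterfly identity is applied to p and G q; G is a shift with a unimodular coefficient, so
     G q has the autocorrelation of q. *)
  by rewrite acorr_nat_butterfly ?conj_xi_re // acorr_natCXM conj_xi_imM mul1r Qpq
     mulr0.
(* The recursion starts at A and B, whose coefficients are the entries of a and b. *)
rewrite !(eq_acorr_nat _ (coef_Poly _)).
by have /golay_pairP-> := hab; rewrite ?size_tuple.
Qed.
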